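(* For every real number $b > 1$, the limit $\lim_{n \to \infty} M_b(n)$ exists (as a finite real number).
   Context: For a positive integer $n$ and a real number $b > 1$, $M_b(n)$ denotes the maximum of the absolute values of the entries of the inverse of the (invertible) $n \times n$ Vandermonde matrix $V(b^0, b^1, \ldots, b^{n-1}) = [b^{ij}]_{0 \leq i,j < n}$. *)

(* Defs.v *)
From mathcomp Require Import all_boot all_order all_algebra.
From mathcomp Require Import all_classical all_reals all_analysis.
Set Implicit Arguments.
Unset Strict Implicit.
Unset Printing Implicit Defensive.
Import Order.TTheory GRing.Theory Num.Theory.
Import numFieldNormedType.Exports.
Local Open Scope ring_scope.

Definition geomVandermonde (R : realType) (b : R) (n : nat) : 'M[R]_n :=
  Vandermonde n (\row_(j < n) b ^+ j).

Lemma geomVandermondeE (R : realType) (b : R) (n : nat) (i j : 'I_n) :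
  geomVandermonde b n i j = b ^+ (i * j).
Proof. by rewrite !mxE -exprM mulnC. Qed.

(* [invmx] is the identity on singular matrices; this lemma shows that for
   b > 1 it is the genuine inverse. *)
Lemma geomVandermonde_unit (R : realType) (b : R) (n : nat) :
  1 < b -> geomVandermonde b n \in unitmx.
Proof.
move=> b1; rewrite unitmxE det_Vandermonde unitfE.
apply/prodf_neq0 => i _; apply/prodf_neq0 => j ij.
by rewrite !mxE subr_eq0 gt_eqF // ltr_eXn2l.
Qed.

(* The default 0 of the iterated maximum does not affect the value for n > 0,
   since absolute values are nonnegative; for n = 0 the maximum is 0. *)
Definition maxInvVandermonde (R : realType) (b : R) (n : nat) : R :=
  \big[Num.max/0]_(i < n) \big[Num.max/0]_(j < n)
    `|invmx (geomVandermonde b n) i j|.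

(* Main.v *)
Require Import Defs.
From mathcomp Require Import all_boot all_order all_algebra.
From mathcomp Require Import all_classical all_reals all_analysis.
From mathcomp Require Import ring zify.
Import Order.TTheory GRing.Theory Num.Theory.
Import numFieldNormedType.Exports.
Local Open Scope classical_set_scope.
Local Open Scope ring_scope.

(** The inverse of V(b^0, ..., b^(n-1)) has as rows the coefficients of the
    Lagrange polynomials, which are the products over k != i, k < n of
    (1 - x / b^k) / (1 - b^i / b^k).  The numerators have alternating
    coefficients, so the absolute value of the (i, j) entry is the coefficient
    of x^j in prod (1 + x / b^k) divided by prod |1 - b^i / b^k|.  Going from n
    to n + 1 increases the former and multiplies the latter by
    1 - b^i / b^n, which lies in ]0, 1].  Hence every entry, and so the
    maximum, is nondecreasing in n; it is bounded since the products
    prod (1 + b^-k) and prod 1 / (1 - b^-|i-k|) are bounded uniformly in i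
    and n. *)

(** * Coefficients of products of linear factors *)

Lemma coef_mul_linear {R : comNzRingType} (p : {poly R}) (a : R) (j : nat) :
  (p * (1 + a *: 'X))`_j = p`_j + a * (if j == 0 then 0 else p`_j.-1).
Proof. by rewrite mulrDr mulr1 -scalerAr coefD coefZ coefMX. Qed.

Lemma coef_prod_linear_ge0 {R : numDomainType} (r : seq nat) (P : pred nat)
    (a : nat -> R) (j : nat) : (forall k, 0 <= a k) ->
  0 <= (\prod_(k <- r | P k) (1 + a k *: 'X))`_j.
Proof.
move=> a0; elim: r j => [|k r IH] j; first by rewrite big_nil coef1 ler0n.
rewrite big_cons; case: ifP => // _; rewrite mulrC coef_mul_linear.
by rewrite addr_ge0 ?IH// mulr_ge0//; case: ifP.
Qed.

(** Negating every [a k] amounts to substituting [-x] for [x]. *)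
Lemma coef_prod_linearN {R : comNzRingType} (r : seq nat) (P : pred nat)
    (a : nat -> R) (j : nat) :
  (\prod_(k <- r | P k) (1 + - a k *: 'X))`_j =
  (-1) ^+ j * (\prod_(k <- r | P k) (1 + a k *: 'X))`_j.
Proof.
elim: r j => [|k r IH] j.
  by rewrite !big_nil coef1; case: j => [|j]; rewrite ?mulr0// mul1r.
rewrite !big_cons; case: ifP => // _.
rewrite ![(1 + _) * _]mulrC !coef_mul_linear !IH.
by case: j => [|j] /=; rewrite ?exprS; ring.
Qed.

Lemma norm_coef_prod_linearN {R : numDomainType} (r : seq nat) (P : pred nat)
    (a : nat -> R) (j : nat) : (forall k, 0 <= a k) ->
  `|(\prod_(k <- r | P k) (1 + - a k *: 'X))`_j| =
  (\prod_(k <- r | P k) (1 + a k *: 'X))`_j.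
Proof.
move=> a0; rewrite coef_prod_linearN normrM normrX normrN1 expr1n mul1r.
by rewrite ger0_norm ?coef_prod_linear_ge0.
Qed.

Lemma coef_le_horner1 {R : numDomainType} {p : {poly R}} (j : nat) :
  (forall k, 0 <= p`_k) -> p`_j <= p.[1].
Proof.
move=> p0; rewrite horner_coef.
under eq_bigr do rewrite expr1n mulr1.
have [jp|pj] := ltnP j (size p); last by rewrite nth_default// sumr_ge0.
by rewrite (bigD1 (Ordinal jp))//= lerDl sumr_ge0.
Qed.

(** * Geometric sums and an exponential bound *)

Lemma sum_expr_le {R : numFieldType} {q : R} (n : nat) : 0 <= q < 1 ->
  \sum_(0 <= k < n) q ^+ k <= (1 - q)^-1.
Proof.
move=> /andP[q0 q1]; have q1' : 0 < 1 - q by rewrite subr_gt0.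
rewrite -[leRHS]mul1r ler_pdivlMr// mulrC big_mkord.
by rewrite -opprB mulNr -subrX1 opprB gerBl exprn_ge0.
Qed.

(* The exponent is |i - k|: one of the two truncated differences is 0. *)
Lemma sum_expr_dist_le {R : numFieldType} {q : R} {i n : nat} : 0 <= q < 1 ->
  (i < n)%N ->
  \sum_(0 <= k < n) q ^+ ((i - k) + (k - i)) <= 2 / (1 - q).
Proof.
move=> q01 lin; have /andP[q0 q1] := q01.
(* Split at [k = i]: reversing the lower part and shifting the upper one leaves exponents at least
   [k], hence two geometric sums. *)
rewrite mulr_natl mulr2n (big_cat_nat (leq0n i) (ltnW lin))/=.
apply: lerD.
  rewrite big_nat_rev/=; apply: le_trans (sum_expr_le i q01).
  rewrite big_nat [leRHS]big_nat; apply: ler_sum => k /andP[_ ki].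
  rewrite ler_wiXn2l// ?(ltW q1)//.
  by rewrite add0n subKn// (leq_trans (leqnSn k))// leq_addr.
rewrite -{1}[i]add0n big_addn; apply: le_trans (sum_expr_le (n - i) q01).
apply: ler_sum => k _.
by rewrite addnK ler_wiXn2l// ?(ltW q1)// leq_addl.
Qed.

(** Follows from [1 / (1 - x) = 1 + x / (1 - x)] and [1 + t <= expR t]. The exponent is made linear
    in [x] so that a product of such factors is controlled by a geometric sum. *)
Lemma inv_one_sub_le_expR {R : realType} (q x : R) :
  0 <= x -> x <= q -> q < 1 -> (1 - x)^-1 <= expR (x / (1 - q)).
Proof.
move=> x0 xq q1; have x1 : x < 1 by exact: le_lt_trans q1.
have -> : (1 - x)^-1 = 1 + x / (1 - x).
  by field; rewrite subr_eq0 gt_eqF.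
apply: le_trans (expR_ge1Dx _); rewrite lerD2l ler_wpM2l// lef_pV2.
- by rewrite lerD2l lerN2.
- by rewrite posrE subr_gt0.
- by rewrite posrE subr_gt0.
Qed.

Lemma prod_neq_recr {R : pzSemiRingType} {n i : nat} (F : nat -> R) :
  (i < n)%N ->
  \prod_(0 <= k < n.+1 | k != i) F k = (\prod_(0 <= k < n | k != i) F k) * F n.
Proof.
by move=> lin; rewrite big_mkcond big_nat_recr//= -big_mkcond gtn_eqF.
Qed.

(** * Entries of the inverse as Lagrange coefficients *)

Section Entries.
Context {R : realType} (b : R).
Hypothesis hb : 1 < b.

Let b_gt0 : 0 < b. Proof. exact: lt_trans hb. Qed.
Let b_neq0 : b != 0. Proof. by rewrite gt_eqF. Qed.
Let q_ge0 : 0 <= b^-1. Proof. by rewrite invr_ge0 ltW. Qed.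
Let q_lt1 : b^-1 < 1. Proof. by rewrite invf_lt1. Qed.

(** Factors are scaled to constant term 1 rather than made monic, so that the matching denominators
    shrink in absolute value, instead of blowing up, as [n > i] grows. *)
Definition lagrange_num (n i : nat) : {poly R} :=
  \prod_(0 <= k < n | k != i) (1 + - b^-1 ^+ k *: 'X).

Definition lagrange_den (n i : nat) : R :=
  \prod_(0 <= k < n | k != i) (1 - b ^+ i * b^-1 ^+ k).

Definition abs_entry (n i j : nat) : R :=
  `|(lagrange_num n i)`_j| / `|lagrange_den n i|.

Lemma horner_lagrange_num (n i : nat) (x : R) :
  (lagrange_num n i).[x] = \prod_(0 <= k < n | k != i) (1 - x * b^-1 ^+ k).
Proof.
rewrite horner_prod; apply: eq_bigr => k _.
by rewrite !hornerE mulNr mulrC.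
Qed.

Lemma lagrange_factor_neq0 (i k : nat) : k != i -> 1 - b ^+ i * b^-1 ^+ k != 0.
Proof.
move=> ki; rewrite subr_eq0 exprVn eq_sym.
rewrite -(inj_eq (mulIf (expf_neq0 k b_neq0))) mulfVK ?expf_neq0// mul1r.
by rewrite (inj_eq (ieexprIn b_gt0 (negbT (gt_eqF hb)))) eq_sym.
Qed.

Lemma lagrange_den_neq0 (n i : nat) : lagrange_den n i != 0.
Proof.
rewrite /lagrange_den big_mkord; apply/prodf_neq0 => k.
exact: lagrange_factor_neq0.
Qed.

Lemma size_lagrange_num {n : nat} (i : 'I_n) : (size (lagrange_num n i) <= n)%N.
Proof.
rewrite /lagrange_num big_mkord.
(* There are [n - 1] factors of size at most 2, so the product has size at most
   [2(n - 1) + 1 - (n - 1) = n]. *)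
apply: leq_trans (size_prod_leq _ _) _.
rewrite leq_subLR.
have sz (k : 'I_n) : (size (1 + - b^-1 ^+ k *: 'X : {poly R})%R <= 2)%N.
  rewrite (leq_trans (size_polyD _ _))// geq_max size_poly1/=.
  by rewrite (leq_trans (size_scale_leq _ _))// size_polyX.
apply: (@leq_ltn_trans (\sum_(k < n | (k : nat) != i) 2)).
  by apply: leq_sum => k _; exact: sz.
rewrite sum_nat_const.
set c := #|_|; have : c.+1 = n.
  rewrite -[RHS]card_ord [RHS](cardD1 i) inE add1n; congr S.
  by apply: eq_card => k; rewrite !inE/= andbT.
by move=> cn; rewrite muln2 -addnn -cn; lia.
Qed.

(** Multiplying a row of coefficients by column [v] of the Vandermonde matrix evaluates the
    polynomial at [b^v], which gives the Kronecker delta. *)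
Lemma invmx_geomVandermonde (n : nat) (i j : 'I_n) :
  invmx (geomVandermonde b n) i j = (lagrange_num n i)`_j / lagrange_den n i.
Proof.
pose W : 'M[R]_n := \matrix_(i, j) ((lagrange_num n i)`_j / lagrange_den n i).
suff WV : W *m geomVandermonde b n = 1%:M.
  have Vu := geomVandermonde_unit n hb.
  by rewrite -[invmx _]mul1mx -WV mulmxK// mxE.
apply/matrixP => u v; rewrite !mxE.
have -> : \sum_k W u k * geomVandermonde b n k v =
    (lagrange_num n u).[b ^+ v] / lagrange_den n u.
  rewrite (horner_coef_wide _ (size_lagrange_num u)) mulr_suml.
  apply: eq_bigr => k _.
  by rewrite geomVandermondeE mxE -exprM mulrAC [(k * v)%N]mulnC.
rewrite horner_lagrange_num; have [->|uv] := eqVneq u v.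
  by rewrite divff// lagrange_den_neq0.
(* The factor at [k = v] vanishes. *)
rewrite big_mkord (bigD1 v)/= 1?eq_sym// exprVn.
by rewrite mulfV ?expf_neq0// subrr !mul0r.
Qed.

Lemma norm_invmx_geomVandermonde {n : nat} (i j : 'I_n) :
  `|invmx (geomVandermonde b n) i j| = abs_entry n i j.
Proof. by rewrite invmx_geomVandermonde normf_div. Qed.

(** * Monotonicity and uniform bounds of the entries *)

Lemma abs_entryS {n i : nat} (j : nat) : (i < n)%N ->
  abs_entry n i j <= abs_entry n.+1 i j.
Proof.
move=> lin; rewrite /abs_entry /lagrange_num /lagrange_den.
rewrite !norm_coef_prod_linearN; try by move=> k; exact: exprn_ge0.
rewrite !(prod_neq_recr _ lin) normrM.
set D := `|\prod_(_ <= _ < _ | _) _|.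
have D0 : 0 < D by rewrite normr_gt0 lagrange_den_neq0.
have f01 : 0 < 1 - b ^+ i * b^-1 ^+ n <= 1.
  rewrite gerBl mulr_ge0 ?exprn_ge0 ?(ltW b_gt0)// andbT subr_gt0.
  by rewrite exprVn ltr_pdivrMr ?exprn_gt0// mul1r ltr_eXn2l.
have /andP[f0 f1] := f01.
rewrite (gtr0_norm f0); apply: ler_pM.
- by rewrite coef_prod_linear_ge0// => k; exact: exprn_ge0.
- by rewrite invr_ge0 ltW.
- rewrite coef_mul_linear lerDl mulr_ge0 ?exprn_ge0//; case: ifP => // _.
  by rewrite coef_prod_linear_ge0// => k; exact: exprn_ge0.
- by rewrite lef_pV2 ?posrE ?mulr_gt0// ler_piMr// ltW.
Qed.

Lemma inv_lagrange_factor_le (i k : nat) : k != i ->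
  `|1 - b ^+ i * b^-1 ^+ k|^-1 <=
  expR (b^-1 ^+ ((i - k) + (k - i)) / (1 - b^-1)).
Proof.
move=> ki.
have bound m : (0 < m)%N -> 0 < 1 - b^-1 ^+ m /\
    (1 - b^-1 ^+ m)^-1 <= expR (b^-1 ^+ m / (1 - b^-1)).
  move=> m0; have qm : b^-1 ^+ m <= b^-1.
    by rewrite -[leRHS]expr1 ler_wiXn2l// ltW.
  split; first by rewrite subr_gt0 (le_lt_trans qm).
  by apply: inv_one_sub_le_expR => //; exact: exprn_ge0.
have [lki|lik|E] := ltngtP k i; last by rewrite E eqxx in ki.
(* [k <= i] is by definition [k - i == 0], so it rewrites the truncated difference to 0. *)
- rewrite (eqP (ltnW lki)) addn0.
  have [d0 le] := bound (i - k)%N ltac:(by rewrite subn_gt0).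
  apply: le_trans le; rewrite lef_pV2 ?posrE//; last first.
    by rewrite normr_gt0 lagrange_factor_neq0.
  have -> : b ^+ i * b^-1 ^+ k = b ^+ (i - k).
    by rewrite exprVn -{1}(subnK (ltnW lki)) exprD mulfK ?expf_neq0.
  (* With [y = b^(i - k) >= 1], the claim is [1 - 1/y = (y - 1)/y <= y - 1]. *)
  rewrite exprVn; have : 1 <= b ^+ (i - k) by rewrite exprn_ege1// ltW.
  set y := b ^+ (i - k) => y1.
  have y0 : 0 < y by exact: lt_le_trans y1.
  rewrite distrC ger0_norm ?subr_ge0//.
  have -> : 1 - y^-1 = (y - 1) / y by field; rewrite gt_eqF.
  by rewrite ler_pdivrMr// ler_peMr// subr_ge0.
- rewrite (eqP (ltnW lik)) add0n.
  have [d0 le] := bound (k - i)%N ltac:(by rewrite subn_gt0).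
  have -> : b ^+ i * b^-1 ^+ k = b^-1 ^+ (k - i).
    rewrite -{1}(subnK (ltnW lik)) exprD [b^-1 ^+ _ * _]mulrC mulrA.
    by rewrite -exprMn divff// expr1n mul1r.
  by rewrite (gtr0_norm d0).
Qed.

(** The first exponential bounds the coefficient, the second the inverse of the denominator. *)
Lemma abs_entry_le (n i j : nat) : (i < n)%N ->
  abs_entry n i j <= expR (1 - b^-1)^-1 * expR (2 / (1 - b^-1) / (1 - b^-1)).
Proof.
move=> lin; have q01 : 0 <= b^-1 < 1 by rewrite q_ge0 q_lt1.
have q' : 0 <= (1 - b^-1)^-1 by rewrite invr_ge0 subr_ge0 ltW.
apply: ler_pM; rewrite ?invr_ge0//.
- rewrite norm_coef_prod_linearN; last by move=> k; exact: exprn_ge0.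
  (* The coefficients are nonnegative, so each is at most the value at 1, and [1 + t <= expR t]
     reduces that product to a geometric sum. *)
  apply: le_trans (coef_le_horner1 j _) _ => [k|].
    by rewrite coef_prod_linear_ge0// => m; exact: exprn_ge0.
  rewrite horner_prod.
  apply: (@le_trans _ _ (expR (\sum_(0 <= k < n | k != i) b^-1 ^+ k))).
    rewrite expR_sum; apply: ler_prod => k _.
    rewrite !hornerE expR_ge1Dx andbT.
    by rewrite addr_ge0 ?exprn_ge0.
  rewrite ler_expR; apply: le_trans (sum_expr_le n q01).
  rewrite big_mkcond; apply: ler_sum => k _.
  by case: ifP => // _; exact: exprn_ge0.
- rewrite -normfV /lagrange_den -prodfV normr_prod.
  apply: (@le_trans _ _ (expR (\sum_(0 <= k < n | k != i)
      b^-1 ^+ ((i - k) + (k - i)) / (1 - b^-1)))).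
    rewrite expR_sum; apply: ler_prod => k ki.
    by rewrite normr_ge0 normfV inv_lagrange_factor_le.
  rewrite ler_expR -mulr_suml ler_wpM2r//.
  apply: le_trans (sum_expr_dist_le q01 lin).
  rewrite big_mkcond; apply: ler_sum => k _.
  by case: ifP => // _; exact: exprn_ge0.
Qed.

(** * From the entries to their maximum *)

Lemma maxInvVandermonde_ge0 (n : nat) : 0 <= maxInvVandermonde b n.
Proof. by apply: bigmax_ge_id. Qed.

Lemma abs_entry_le_maxInvVandermonde (n i j : nat) : (i < n)%N -> (j < n)%N ->
  abs_entry n i j <= maxInvVandermonde b n.
Proof.
move=> lin ljn; pose u := Ordinal lin; pose v := Ordinal ljn.
rewrite -[abs_entry n i j](norm_invmx_geomVandermonde u v).
apply: le_trans (le_bigmax _ _ u).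
exact: (le_bigmax _ (fun v => `|invmx (geomVandermonde b n) u v|) v).
Qed.

(** The condition [0 <= x] accounts for the default value 0 of the iterated maximum. *)
Lemma maxInvVandermonde_le (n : nat) (x : R) : 0 <= x ->
  (forall i j, (i < n)%N -> (j < n)%N -> abs_entry n i j <= x) ->
  maxInvVandermonde b n <= x.
Proof.
move=> x0 le_x; apply: bigmax_le => // i _; apply: bigmax_le => // j _.
by rewrite norm_invmx_geomVandermonde le_x.
Qed.

Lemma nondecreasing_maxInvVandermonde :
  nondecreasing_seq (maxInvVandermonde b).
Proof.
apply/nondecreasing_seqP => n.
apply: maxInvVandermonde_le => [|i j lin ljn]; first exact: maxInvVandermonde_ge0.
apply: le_trans (abs_entryS j lin) _.
by apply: abs_entry_le_maxInvVandermonde; exact: ltnW.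
Qed.

Lemma has_ubound_maxInvVandermonde : has_ubound (range (maxInvVandermonde b)).
Proof.
exists (expR (1 - b^-1)^-1 * expR (2 / (1 - b^-1) / (1 - b^-1))) => _ [n _ <-].
apply: maxInvVandermonde_le => [|i j lin _]; last exact: abs_entry_le.
by rewrite mulr_ge0 ?expR_ge0.
Qed.

End Entries.

Theorem theorem3 (R : realType) (b : R) (hb : 1 < b) :
  exists l : R, maxInvVandermonde b n @[n --> \oo] --> l.
Proof.
exists (limn (maxInvVandermonde b)).
apply: nondecreasing_is_cvgn.
- exact: nondecreasing_maxInvVandermonde.
- exact: has_ubound_maxInvVandermonde.
Qed.
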